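(* Let $p\geq 3$ be a prime, $k\in \{3,4,\dots,p\}$ and $n\in \mathbb{N}$. Then $$r_k(\mathbb{F}_p^{n+1})\leq \frac{2(p^{n+1}-1)r_k(\mathbb{F}_p^n)+p^n-\sqrt{4(p^{n+1}-1)r_k(\mathbb{F}_p^n)\bigl(p^n-r_k(\mathbb{F}_p^n)\bigr)+p^{2n}}}{2p^n}.$$
   Context: For a prime $p$, an integer $k$ with $3\le k\le p$ and $m\in\mathbb{N}$, a $k$-progression in $\mathbb{F}_p^m$ is a set of $k$ points of the form $\{a+ib : i\in\{0,1,\dots,k-1\}\}$ with $a,b\in\mathbb{F}_p^m$, $b\neq 0$. $r_k(\mathbb{F}_p^m)$ denotes the maximum cardinality of a subset of $\mathbb{F}_p^m$ containing no $k$-progression. *)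

(* Defs.v *)
From mathcomp Require Import all_boot all_order all_algebra.

Set Implicit Arguments.
Unset Strict Implicit.
Unset Printing Implicit Defensive.

Import GRing.Theory.
Local Open Scope ring_scope.

Section Progressions.
Variables (p k m : nat).
Implicit Types (a b : 'rV['F_p]_m) (P A : {set 'rV['F_p]_m}).

Definition progression a b : {set 'rV['F_p]_m} :=
  [set a + b *+ i | i : 'I_k].

Definition is_progression P : bool :=
  [exists a, exists b, (b != 0) && (P == progression a b)].

Definition progression_free A : bool :=
  [forall P, is_progression P ==> ~~ (P \subset A)].

Definition rk : nat := \max_(A | progression_free A) #|A|.

(* For k <= p every progression has exactly k points, so is_progression need
   not require it. *)
Lemma card_progression P :
  prime p -> (k <= p)%N -> is_progression P -> #|P| = k.
Proof.
move=> p_pr le_kp /existsP[a /existsP[b /andP[nz_b /eqP->]]].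
rewrite card_imset ?card_ord // => i j /addrI eq_b; apply: val_inj => /=.
have [c nz_bc] : exists c, b 0 c != 0.
  apply/existsP; apply: contraR nz_b => /existsPn b0; apply/eqP/rowP=> c.
  by rewrite mxE; apply/eqP; move: (b0 c); rewrite negbK.
have : b 0 c * i%:R = b 0 c * j%:R.
  by rewrite !mulr_natr -!mulmxnE eq_b.
move/(mulfI nz_bc)/(congr1 val); rewrite /= !val_Fp_nat //.
by rewrite !modn_small // (leq_trans _ le_kp).
Qed.

End Progressions.

Arguments rk : clear implicits.

(* Main.v *)
(** Let [A] be progression-free in F_p^(n+1), put [X = #|A|], [r = rk p k n],
    and for a linear form [u <> 0] let [a u c] be the size of the section of [A]
    by the hyperplane [u = c].  Each hyperplane is affinely isomorphic to F_p^n,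
    so [a u c <= r] and hence

      0 <= \sum_(u <> 0) \sum_c (r - a u c) (r - a u (c + 1)).

    For [x <> y] exactly p^n forms take the value 1 on [y - x], so the right-hand
    side is [(p^(n+1) - 1) (p r^2 - 2 r X) + p^n X (X - 1)].  Thus [X] is not
    strictly between the roots of this quadratic polynomial in [X].  The bound
    [X <= p r] rules out the larger root, except when [X = p r] and [r = p^n],
    which is impossible because the full space contains a progression. *)

Require Import Defs.
From mathcomp Require Import all_boot all_order all_algebra.
From mathcomp Require Import ring lra.

Set Implicit Arguments.
Unset Strict Implicit.
Unset Printing Implicit Defensive.

Import Order.TTheory GRing.Theory Num.Theory.
Local Open Scope ring_scope.

(** * Hyperplanes over a finite field *)

Section Hyperplanes.
Variables (F : finFieldType) (m : nat).
Implicit Types (u v : 'cV[F]_m) (d x y : 'rV[F]_m).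

Definition pairing d u : F := (d *m u) 0 0.

Lemma pairingBl x y u : pairing (x - y) u = pairing x u - pairing y u.
Proof. by rewrite /pairing mulmxBl [LHS]mxE [X in _ + X]mxE. Qed.

Lemma pairingDZr d u c v : pairing d (u + c *: v) = pairing d u + c * pairing d v.
Proof. by rewrite /pairing mulmxDr -scalemxAr [LHS]mxE [X in _ + X]mxE. Qed.

Lemma pairing0l u : pairing 0 u = 0.
Proof. by rewrite /pairing mul0mx mxE. Qed.

Lemma pairing0r d : pairing d 0 = 0.
Proof. by rewrite /pairing mulmx0 mxE. Qed.

Lemma pairing_onto d : d != 0 -> exists u, pairing d u = 1.
Proof.
move=> /rV0Pn[j dj_neq0]; exists (0 + (d 0 j)^-1 *: delta_mx j 0).
by rewrite pairingDZr pairing0r /pairing -colE mxE add0r mulVf.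
Qed.

(** Adding multiples of a form [u1] with [pairing d u1 = 1] carries any level set of [pairing d]
    onto any other, so the [#|F|] level sets have equal size. *)
Lemma card_pairing_eq1 d : d != 0 ->
  (#|[set u | pairing d u == 1%R]| * #|F| = #|F| ^ m)%N.
Proof.
move=> /pairing_onto[u1 du1].
have fiberE (c : F) : #|[set u | pairing d u == c]| = #|[set u | pairing d u == 1]|.
  rewrite -(card_imset _ (addIr ((1 - c) *: u1))); apply: eq_card => u.
  rewrite !inE; apply/imsetP/eqP => [[v]|du].
    by rewrite inE => /eqP dv ->; rewrite pairingDZr dv du1; ring.
  exists (u + (c - 1) *: u1); last first.
    by rewrite -addrA -scalerDl addrA subrK subrr scale0r addr0.
  by rewrite inE pairingDZr du du1; apply/eqP; ring.
have := card_mx F m 1; rewrite muln1 => <-.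
rewrite -[RHS]sum1_card (partition_big (pairing d) xpredT) //=.
rewrite mulnC -sum_nat_const; apply: eq_bigr => c _.
by rewrite -(fiberE c) sum1dep_card; apply: eq_card => u; rewrite !inE.
Qed.

End Hyperplanes.

(** The rows of [B] parametrize the hyperplane [u = 0] by [F^n], which lets sections be pulled back
    to dimension [n]. *)
Lemma kernel_basis (F : fieldType) n (u : 'cV[F]_n.+1) : u != 0 ->
  exists2 B : 'M[F]_(n, n.+1), row_free B & (B :=: kermx u)%MS.
Proof.
move=> u_neq0; have rank_ker : \rank (kermx u) = n.
  rewrite mxrank_ker -mxrank_tr rank_rV.
  by rewrite -(inj_eq (@trmx_inj _ _ _)) trmxK trmx0 u_neq0 subn1.
have := eq_row_base (kermx u); have := row_base_free (kermx u).
by move: (row_base _); rewrite rank_ker => B; exists B.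
Qed.

(** * Hyperplane sections *)

Section Sections.
Variables (F : finFieldType) (m : nat) (A : {set 'rV[F]_m}).

Definition hsection (u : 'cV[F]_m) c : {set 'rV[F]_m} :=
  [set x in A | pairing x u == c].

Lemma card_hsection u c :
  #|hsection u c| = (\sum_(x in A) (pairing x u == c))%N.
Proof.
by rewrite -sum1dep_card big_mkcondr; apply: eq_bigr => x _; case: eqP.
Qed.

Lemma sum_card_hsection u : (\sum_c #|hsection u c| = #|A|)%N.
Proof.
rewrite -sum1_card (partition_big (fun x => pairing x u) xpredT) //=.
by apply: eq_bigr => c _; rewrite sum1dep_card; apply: eq_card => x; rewrite !inE.
Qed.

Lemma sum_card_hsection_shift u :
  (\sum_c #|hsection u c| * #|hsection u (c + 1)%R| =
   \sum_(x in A) \sum_(y in A) (pairing (y - x)%R u == 1%R))%N.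
Proof.
under eq_bigr => c _ do rewrite !card_hsection big_distrlr.
rewrite exchange_big; apply: eq_bigr => x _.
rewrite exchange_big; apply: eq_bigr => y _.
(* Only the level [c] on which [x] itself lies contributes. *)
rewrite (bigD1 (pairing x u)) //= eqxx mul1n big1 ?addn0 => [|c /negPf].
  by rewrite pairingBl subr_eq addrC.
by rewrite eq_sym => ->.
Qed.

(** Double counting: a pair [x = y] contributes nothing, and a pair [x != y] contributes the forms
    equal to 1 on [y - x]. The factor [#|F|] avoids the exponent [m - 1]. *)
Lemma sum_hsection_correlations :
  (#|F| * \sum_(u | u != 0%R) \sum_c #|hsection u c| * #|hsection u (c + 1)%R| =
   #|A| * #|A|.-1 * #|F| ^ m)%N.
Proof.
under eq_bigr => u _ do rewrite sum_card_hsection_shift.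
rewrite exchange_big /= -mulnA -[RHS]sum_nat_const big_distrr; apply: eq_bigr => x xA.
rewrite exchange_big /= (bigD1 x) //= subrr.
rewrite big1 ?add0n => [|u _]; last by rewrite pairing0l eq_sym oner_eq0.
have -> : #|A|.-1 = #|[set y in A | y != x]|.
  by rewrite (cardsD1 x) xA; apply: eq_card => y; rewrite !inE andbC.
rewrite -sum_nat_cond_const big_distrr /=.
apply: eq_bigr => y /andP[_ y_neq_x].
rewrite mulnC -(@card_pairing_eq1 _ _ (y - x)) ?subr_eq0 //; congr (_ * _)%N.
rewrite -sum1dep_card big_mkcond [RHS]big_mkcond /=; apply: eq_bigr => u _.
(* The zero form never takes the value 1, so excluding it changes no count. *)
have [->|u_neq0] := eqVneq u 0; first by rewrite pairing0r eq_sym oner_eq0.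
by case: eqP.
Qed.

End Sections.

(** * Progression-free sets *)

Section ProgressionFree.
Variables (p k : nat).

Lemma progression_free_card_le m (A : {set 'rV['F_p]_m}) :
  progression_free k A -> (#|A| <= rk p k m)%N.
Proof. by move=> freeA; exact: (@leq_bigmax_cond _ _ (fun A : {set _} => #|A|)). Qed.

Lemma rk_le m : prime p -> (rk p k m <= p ^ m)%N.
Proof.
move=> p_pr; apply/bigmax_leqP => A _; apply: leq_trans (max_card _) _.
by rewrite card_mx mul1n card_Fp.
Qed.

Lemma progression_free_lt m (A : {set 'rV['F_p]_m.+1}) : prime p ->
  progression_free k A -> (#|A| < p ^ m.+1)%N.
Proof.
move=> p_pr freeA; rewrite -[X in (_ < X ^ _)%N](card_Fp p_pr).
have := card_mx 'F_p 1 m.+1; rewrite mul1n => <-; rewrite -cardsT.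
apply: proper_card; rewrite properT; apply/eqP => AT.
have /forallP/(_ (progression k 0 (const_mx 1))) := freeA.
rewrite AT subsetT implybF => /negP; apply.
apply/existsP; exists 0; apply/existsP; exists (const_mx 1); rewrite eqxx andbT.
by apply/rV0Pn; exists 0; rewrite mxE oner_eq0.
Qed.

(** The affine map [y -> w + y *m B] sends progressions to progressions; injectivity keeps the
    difference nonzero. *)
Lemma progression_free_preim m m' (B : 'M['F_p]_(m, m')) w (A : {set 'rV_m'}) :
    row_free B -> progression_free k A ->
  progression_free k [set y | w + y *m B \in A].
Proof.
move=> freeB freeA; apply/forallP => P; apply/implyP.
move=> /existsP[a /existsP[b /andP[b_neq0 /eqP->]]].
have /forallP/(_ (progression k (w + a *m B) (b *m B))) := freeA.
have -> : is_progression k (progression k (w + a *m B) (b *m B)).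
  apply/existsP; exists (w + a *m B); apply/existsP; exists (b *m B).
  rewrite eqxx andbT; apply: contra b_neq0 => /eqP bB0.
  by apply/eqP/(row_free_inj freeB); rewrite bB0 mul0mx.
apply: contra => /subsetP sPA; apply/subsetP => _ /imsetP[i _ ->].
have : a + b *+ i \in [set y | w + y *m B \in A] by apply/sPA/imset_f.
by rewrite inE mulmxDl -scaler_nat -scalemxAl scaler_nat addrA.
Qed.

Lemma card_hsection_le n (A : {set 'rV['F_p]_n.+1}) u c :
  u != 0 -> progression_free k A ->
  (#|hsection A u c| <= rk p k n)%N.
Proof.
move=> u_neq0 freeA.
have [->|[w]] := set_0Vmem (hsection A u c); first by rewrite cards0.
rewrite inE => /andP[_ /eqP wu]; have [B freeB eqB] := kernel_basis u_neq0.
(* Any point [w] of the section serves as origin: the section lies in [w] plus the row space of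
   [B]. *)
apply: leq_trans (progression_free_card_le (progression_free_preim w freeB freeA)).
rewrite -[leqRHS](card_imset _ (inj_comp (addrI w) (row_free_inj freeB))).
apply/subset_leq_card/subsetP => x; rewrite inE => /andP[xA /eqP xu].
have : (x - w <= B)%MS.
  rewrite eqB; apply/sub_kermxP/matrixP => i j; rewrite !ord1 [RHS]mxE.
  by rewrite -[LHS]/(pairing _ u) pairingBl xu wu subrr.
by move=> /submxP[y yB]; apply/imsetP; exists y; rewrite ?inE /= -yB addrC subrK.
Qed.

Lemma card_progression_free_le n (A : {set 'rV['F_p]_n.+1}) :
  prime p -> progression_free k A -> (#|A| <= p * rk p k n)%N.
Proof.
move=> p_pr freeA; rewrite -(sum_card_hsection A (const_mx 1)).
rewrite -[X in (X * _)%N](card_Fp p_pr) -sum_nat_const; apply: leq_sum => c _.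
apply: card_hsection_le freeA; apply/matrix0Pn; exists 0, 0.
by rewrite mxE oner_neq0.
Qed.

Lemma progression_free_quadratic (R : realFieldType) n (A : {set 'rV['F_p]_n.+1}) :
    prime p -> progression_free k A ->
  let r : R := (rk p k n)%:R in let q : R := p%:R in let X : R := #|A|%:R in
  0 <= (q ^+ n.+1 - 1) * (q * r ^+ 2 - 2 * r * X) + q ^+ n * X * (X - 1).
Proof.
move=> p_pr freeA; cbv zeta.
set r : R := (rk p k n)%:R; set q : R := p%:R; set X : R := #|A|%:R.
have p_gt0 : 0 < q by rewrite ltr0n prime_gt0.
pose a u c : R := #|hsection A u c|%:R.
have sum_a u : \sum_c a u c = X by rewrite -natr_sum sum_card_hsection.
have corr : \sum_(u | u != 0) \sum_c a u c * a u (c + 1) = q ^+ n * X * (X - 1).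
  apply: (mulfI (lt0r_neq0 p_gt0)).
  have := congr1 (fun N => N%:R : R) (sum_hsection_correlations A).
  rewrite card_Fp // !natrM natr_sum natrX -/q -/X => corrR.
  transitivity (X * #|A|.-1%:R * q ^+ n.+1).
    rewrite -corrR; congr (_ * _); apply: eq_bigr => u _.
    by rewrite natr_sum; apply: eq_bigr => c _; rewrite natrM.
  (* The truncated [#|A|.-1] differs from [X - 1] only for empty [A], where the factor [X]
     vanishes. *)
  rewrite /X; case: #|A| => [|N]; first by rewrite !(mul0r, mulr0).
  by rewrite -natr1 exprS /=; ring.
have expand u : \sum_c (r - a u c) * (r - a u (c + 1)) =
    q * r ^+ 2 - 2 * r * X + \sum_c a u c * a u (c + 1).
  transitivity (\sum_c (r ^+ 2 - r * a u c - r * a u (c + 1) + a u c * a u (c + 1))).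
    by apply: eq_bigr => c _; ring.
  rewrite big_split !sumrB /= -!mulr_sumr sum_a sumr_const card_Fp // -mulr_natl -/q.
  have -> : \sum_c a u (c + 1) = X.
    by rewrite -(sum_a u) [RHS](reindex_inj (addIr 1)).
  by ring.
have card_forms : #|[pred u : 'cV['F_p]_n.+1 | u != 0]|%:R = q ^+ n.+1 - 1 :> R.
  have := card_mx 'F_p n.+1 1; rewrite muln1 card_Fp //.
  rewrite (cardD1 0) inE /= => /(congr1 (fun N => N%:R : R)).
  rewrite natrD natrX => <-; rewrite addrC addKr; congr _%:R.
  by apply: eq_card => u; rewrite !inE andbT.
have : 0 <= \sum_(u | u != 0) \sum_c (r - a u c) * (r - a u (c + 1)).
  apply: sumr_ge0 => u u_neq0; apply: sumr_ge0 => c _.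
  by apply: mulr_ge0; rewrite subr_ge0 ler_nat card_hsection_le.
under eq_bigr => u _ do rewrite expand.
by rewrite big_split /= corr sumr_const -card_forms [_%:R * (q * _ - _)]mulr_natl.
Qed.

End ProgressionFree.

(** Here [Q] stands for [p ^ n]. Completing the square bounds the discriminant by
    [(b - 2 * Q * X) ^+ 2]; once [X] is known to be at most the vertex [b / (2 * Q)], taking square
    roots gives the claim. *)
Lemma le_smaller_root (R : rcfType) (p Q r X : R) :
    0 < Q -> 0 < p -> 0 <= p * Q - 1 -> 0 <= r -> r <= Q -> X <= p * r ->
    X < p * Q ->
    0 <= (p * Q - 1) * (p * r ^+ 2 - 2 * r * X) + Q * X * (X - 1) ->
  X <= (2 * (p * Q - 1) * r + Q
        - Num.sqrt (4 * (p * Q - 1) * r * (Q - r) + Q ^+ 2)) / (2 * Q).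
Proof.
move=> Q_gt0 p_gt0 D_ge0 r_ge0 r_leQ X_le X_lt fX_ge0.
set b := 2 * (p * Q - 1) * r + Q.
have b_gt0 : 0 < b by rewrite ltr_wpDl // !mulr_ge0.
have b_ge : 2 * Q * X <= b.
  rewrite leNgt; apply/negP => b_lt.
  (* Past the vertex the polynomial increases, and it is nonpositive at [p * r]. *)
  have incr : (p * Q - 1) * (p * r ^+ 2 - 2 * r * X) + Q * X * (X - 1)
      = p * r * (r - Q) - (p * r - X) * (Q * (p * r + X) - b) by rewrite /b; ring.
  (* This is [(2 * Q * X - b) + Q * (p * r - X)]. *)
  have slope_gt0 : 0 < Q * (p * r + X) - b.
    have : 0 <= Q * (p * r - X) by rewrite mulr_ge0 ?subr_ge0 // ltW.
    lra.
  have fpr_le0 : p * r * (r - Q) <= 0.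
    by rewrite mulr_ge0_le0 ?mulr_ge0 ?subr_le0 // ltW.
  have X_eq : X = p * r.
    apply/eqP; rewrite eq_le X_le leNgt; apply/negP => X_lt_pr.
    have : 0 < (p * r - X) * (Q * (p * r + X) - b).
      by rewrite mulr_gt0 // subr_gt0.
    lra.
  (* In the remaining case the value is [p * r * (r - Q)], which is negative since [0 < r < Q]. *)
  move: X_lt b_lt incr; rewrite X_eq ltr_pM2l // => r_ltQ b_lt incr.
  have r_gt0 : 0 < r.
    rewrite lt_def r_ge0 andbT; apply/eqP => r0.
    by move: b_lt; rewrite r0 !mulr0 ltNge ltW.
  have : 0 < p * r * (Q - r) by rewrite !mulr_gt0 ?subr_gt0.
  by move: fX_ge0; rewrite X_eq incr; lra.
have disc_le : 4 * (p * Q - 1) * r * (Q - r) + Q ^+ 2 <= (b - 2 * Q * X) ^+ 2.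
  rewrite -subr_ge0 (_ : _ - _ = 4 * Q *
    ((p * Q - 1) * (p * r ^+ 2 - 2 * r * X) + Q * X * (X - 1))).
    by rewrite !mulr_ge0 // ltW.
  by rewrite /b; ring.
rewrite ler_pdivlMr ?mulr_gt0 //.
have := ler_wsqrtr disc_le; rewrite sqrtr_sqr ger0_norm ?subr_ge0 //; lra.
Qed.

Theorem theorem1p3 (R : rcfType) (p k n : nat)
    (hp : prime p) (hp3 : (3 <= p)%N) (hk3 : (3 <= k)%N) (hkp : (k <= p)%N) :
  let r : R := (rk p k n)%:R in
  let q : R := p%:R in
  (rk p k n.+1)%:R <=
    (2 * (q ^+ n.+1 - 1) * r + q ^+ n
     - Num.sqrt (4 * (q ^+ n.+1 - 1) * r * (q ^+ n - r) + q ^+ (2 * n)))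
    / (2 * q ^+ n).
Proof.
cbv zeta; set r : R := (rk p k n)%:R; set q : R := p%:R.
have [A freeA ->] : exists2 A : {set 'rV['F_p]_n.+1},
    progression_free k A & rk p k n.+1 = #|A|.
  have [|A freeA eqA] := @eq_bigmax_cond _ (@progression_free p k n.+1) (fun A => #|A|).
    (* The maximum is attained because the family is nonempty: progressions have [k > 0] points, so
       [set0] contains none. *)
    apply/card_gt0P; exists set0; apply/forallP => P; apply/implyP => Pprog.
    by rewrite subset0 -card_gt0 (card_progression hp hkp Pprog) (leq_trans _ hk3).
  by exists A.
have q_ge1 : 1 <= q by rewrite ler1n prime_gt0.
have q_gt0 : 0 < q by apply: lt_le_trans q_ge1.
rewrite mulnC exprM exprS; apply: le_smaller_root; rewrite ?exprn_gt0 //.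
- by rewrite -exprS subr_ge0 exprn_ege1.
- by rewrite /r /q -natrX ler_nat rk_le.
- by rewrite /r /q -natrM ler_nat card_progression_free_le.
- by rewrite /r /q -exprS -natrX ltr_nat (@progression_free_lt p k).
- by rewrite -exprS; apply: progression_free_quadratic.
Qed.
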